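(* Let $\mathbf M\in\mathbb R^{n\times p}$ and let $s\ge 1$ be an integer. If the restricted isometry constants of $\mathbf M$ at order $2s$ satisfy $$\gamma(2s,n,p):=\frac{1+\mathfrak c_{\max}(2s,\mathbf M)}{1-\mathfrak c_{\min}(2s,\mathbf M)}<\frac{(4+\sqrt{41})^2}{25},$$ then the Stable and Robust Sparse Recovery (SRSR) property of order $s$ holds for $\mathbf M$, with positive constants $C$ and $D$ depending only on $\mathfrak c_{\min}(2s,\mathbf M)$ and $\mathfrak c_{\max}(2s,\mathbf M)$.
   Context: $\Sigma_s\subset\mathbb R^p$ is the set of vectors with at most $s$ nonzero coordinates. Restricted isometry constants: $\mathfrak c_{\min}(s,\mathbf M)$ is the smallest $c_-\ge 0$ such that $(1-c_-)\|x\|_2^2\le\|\mathbf Mx\|_2^2$ for all $x\in\Sigma_s$, and $\mathfrak c_{\max}(s,\mathbf M)$ is the smallest $c_+\ge 0$ such that $(1+c_+)\|x\|_2^2\ge\|\mathbf Mx\|_2^2$ for all $x\in\Sigma_s$. (One always has $\mathfrak c_{\min}\le 1$; the ratio $\gamma$ is understood to be $+\infty$ if $\mathfrak c_{\min}(2s,\mathbf M)=1$, so that the condition implies $\mathfrak c_{\min}(2s,\mathbf M)<1$.) For $x_0\in\mathbb R^p$, $\sigma_s(x_0)_1:=\min_{x\in\Sigma_s}\|x_0-x\|_1$. SRSR of order $s$ with constants $C,D>0$ means: for every $x_0\in\mathbb R^p$, every $\eta>0$, every $\mathbf e\in\mathbb R^n$ with $\|\mathbf e\|_2\le\eta$, setting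 $y=\mathbf Mx_0+\mathbf e$, every solution $\hat x$ of $$\min\|x\|_1\quad\text{subject to}\quad\|y-\mathbf Mx\|_2\le\eta$$ satisfies both $$\|x_0-\hat x\|_1\le C\,\sigma_s(x_0)_1+D\sqrt s\,\eta\qquad\text{and}\qquad \|x_0-\hat x\|_2\le\frac{C}{\sqrt s}\,\sigma_s(x_0)_1+D\,\eta .$$ *)

(* Defs.v *)
From mathcomp Require Import all_boot all_order all_algebra.
From mathcomp Require Import classical_sets reals constructive_ereal.

Set Implicit Arguments.
Unset Strict Implicit.
Unset Printing Implicit Defensive.

Import Order.TTheory GRing.Theory Num.Theory.
Local Open Scope classical_set_scope.
Local Open Scope ring_scope.

Definition norm1 (R : realType) (m : nat) (x : 'cV[R]_m) : R :=
  \sum_(i < m) `|x i 0|.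

Definition norm2 (R : realType) (m : nat) (x : 'cV[R]_m) : R :=
  Num.sqrt (\sum_(i < m) x i 0 ^+ 2).

Definition sparse (R : realType) (p s : nat) : set 'cV[R]_p :=
  [set x : 'cV[R]_p | (#|[pred i | x i 0%R != 0%R]| <= s)%N].

(* The infima in [cmin], [cmax] and [sigma1] are minima: the sets of admissible
   constants are nonempty, closed and contained in [0, +oo), and the distance of
   x0 to the finite union of coordinate subspaces [sparse s] is attained. *)
Definition cmin (R : realType) (n p : nat) (s : nat) (M : 'M[R]_(n, p)) : R :=
  inf [set c : R | 0 <= c /\
    forall x, sparse s x -> (1 - c) * norm2 x ^+ 2 <= norm2 (M *m x) ^+ 2].

Definition cmax (R : realType) (n p : nat) (s : nat) (M : 'M[R]_(n, p)) : R :=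
  inf [set c : R | 0 <= c /\
    forall x, sparse s x -> (1 + c) * norm2 x ^+ 2 >= norm2 (M *m x) ^+ 2].

(* Extended-real valued: as [cmin] never exceeds 1, the denominator can only
   degenerate by vanishing, and the ratio is then infinite. *)
Definition ric_ratio (R : realType) (n p : nat) (s : nat) (M : 'M[R]_(n, p)) :
    \bar R :=
  if cmin s M == 1 then +oo%E else ((1 + cmax s M) / (1 - cmin s M))%:E.

Definition sigma1 (R : realType) (p : nat) (s : nat) (x0 : 'cV[R]_p) : R :=
  inf [set norm1 (x0 - x) | x in sparse s].

Definition bpdn_feasible (R : realType) (n p : nat) (M : 'M[R]_(n, p))
    (y : 'cV[R]_n) (eta : R) : set 'cV[R]_p :=
  [set x | norm2 (y - M *m x) <= eta].

Definition bpdn_solution (R : realType) (n p : nat) (M : 'M[R]_(n, p))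
    (y : 'cV[R]_n) (eta : R) : set 'cV[R]_p :=
  [set x | bpdn_feasible M y eta x /\
    forall z, bpdn_feasible M y eta z -> norm1 x <= norm1 z].

Definition SRSR (R : realType) (n p : nat) (s : nat) (M : 'M[R]_(n, p))
    (C D : R) : Prop :=
  forall (x0 : 'cV[R]_p) (eta : R) (e : 'cV[R]_n),
    0 < eta -> norm2 e <= eta ->
    forall xhat, bpdn_solution M (M *m x0 + e) eta xhat ->
      norm1 (x0 - xhat) <= C * sigma1 s x0 + D * Num.sqrt s%:R * eta /\
      norm2 (x0 - xhat) <= C / Num.sqrt s%:R * sigma1 s x0 + D * eta.

(* Main.v *)
Require Import Defs.
From mathcomp Require Import all_boot all_order all_algebra.
From mathcomp Require Import classical_sets reals constructive_ereal.
From mathcomp Require Import fintype finset ring lra.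

(** Write [a = 1 - cmin] and [b = 1 + cmax] for the restricted isometry constants
    of order [2s], so that [a |x|^2 <= |M x|^2 <= b |x|^2] for all [2s]-sparse [x].

    The core is a robust null space property for the set [S] of the [s] largest
    entries of a vector [v].  Cut the other entries into blocks of size [s] in
    decreasing order and expand [|M v_S|^2 = <M v_S, M v> - sum_k <M v_S, M v_k>].
    Three estimates control the right-hand side.
    - Near orthogonality ([near_orthogonality]): on the span of two disjointly
      supported [s]-sparse vectors [u], [w] both [b |x|^2 - |M x|^2] and
      [|M x|^2 - a |x|^2] are nonnegative quadratic forms.  Combining their
      discriminant inequalities gives
      [|<M u, M w>| |u| <= kappa |M u|^2 |w|] with the coherence
      [kappa = (b - a) / (2 sqrt (a b))].
    - Square-root lifting ([sqrt_sum_sqr_le]): a block with entries in [[m, mu]]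
      has Euclidean norm at most its l1 norm over [sqrt s], plus
      [sqrt s / 4 * (mu - m)].
    - The second terms telescope over the blocks ([additive_le_blocks]); their sum
      is at most [sqrt s / 4] times the least modulus on [S], hence at most
      [|v_S| / 4].

    Together, [|v_S| <= kappa (|v_(~S)|_1 / sqrt s + |v_S| / 4) + |M v| / sqrt a],
    that is [|v_S| <= rho |v_(~S)|_1 / sqrt s + tau |M v|] with
    [rho = kappa / (1 - kappa / 4)] ([robust_null_space]).  Recovery needs
    [rho < 1], that is [kappa < 4/5], that is [25 (b - a)^2 < 64 a b]; the larger
    root of the corresponding quadratic in [b / a] is [(4 + sqrt 41)^2 / 25]
    ([coherence_lt]).

    The null space property yields recovery in the classical way: with
    [v = x0 - xhat], minimality of [xhat] bounds the l1 norm of [v] off any set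
    [T] by its l1 norm on [T] plus twice the l1 norm of [x0] off [T], and
    feasibility of both vectors gives [|M v| <= 2 eta].  Taking for [T] the support
    of a competing sparse vector and passing to the infimum produces [sigma1]. *)

Set Implicit Arguments.
Unset Strict Implicit.
Unset Printing Implicit Defensive.

Import Order.TTheory GRing.Theory Num.Theory.
Local Open Scope ring_scope.

(** * Euclidean geometry of column vectors *)

Definition dot (R : realType) (m : nat) (x y : 'cV[R]_m) : R :=
  \sum_(i < m) x i 0 * y i 0.

Section Euclid.
Context {R : realType}.

Lemma dotDr (m : nat) (x y z : 'cV[R]_m) : dot x (y + z) = dot x y + dot x z.
Proof. by rewrite /dot -big_split; apply: eq_bigr => i _; rewrite mxE mulrDr. Qed.

Lemma dot0r (m : nat) (x : 'cV[R]_m) : dot x 0 = 0.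
Proof. by rewrite /dot big1 // => i _; rewrite mxE mulr0. Qed.

Lemma norm2_ge0 (m : nat) (x : 'cV[R]_m) : 0 <= norm2 x.
Proof. exact: sqrtr_ge0. Qed.

Lemma sqr_norm2 (m : nat) (x : 'cV[R]_m) : norm2 x ^+ 2 = dot x x.
Proof.
rewrite sqr_sqrtr; last by apply: sumr_ge0 => i _; exact: sqr_ge0.
by apply: eq_bigr => i _; rewrite expr2.
Qed.

Lemma norm2_eq0 (m : nat) (x : 'cV[R]_m) : norm2 x = 0 -> x = 0.
Proof.
move=> x0; have := sqr_norm2 x; rewrite x0 expr0n => /esym /eqP.
rewrite psumr_eq0 => [/allP x_0|i _]; last by rewrite -expr2 sqr_ge0.
apply/colP => i; rewrite mxE; apply/eqP.
by have := x_0 i (mem_index_enum i); rewrite /= mulf_eq0 orbb.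
Qed.

Lemma norm2_sqr_comb (m : nat) (x y : 'cV[R]_m) (al be : R) :
  norm2 (al *: x + be *: y) ^+ 2 =
  al ^+ 2 * norm2 x ^+ 2 + 2 * al * be * dot x y + be ^+ 2 * norm2 y ^+ 2.
Proof.
rewrite !sqr_norm2 /dot !mulr_sumr -!big_split; apply: eq_bigr => i _ /=.
by rewrite !mxE; ring.
Qed.

(** The discriminant of a nonnegative binary quadratic form is nonpositive. *)
Lemma sqr_le_psd (P r Q : R) :
  (forall al be : R, 0 <= al ^+ 2 * P + 2 * al * be * r + be ^+ 2 * Q) ->
  r ^+ 2 <= P * Q.
Proof.
move=> psd.
have P_ge0 : 0 <= P by have := psd 1 0; lra.
have Q_ge0 : 0 <= Q by have := psd 0 1; lra.
have [P_gt0|P_le0] := ltP 0 P.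
  have : 0 <= P * (P * Q - r ^+ 2).
    rewrite [leRHS](_ : _ = r ^+ 2 * P + 2 * r * (- P) * r + (- P) ^+ 2 * Q).
      exact: psd.
    by ring.
  by rewrite pmulr_rge0 // subr_ge0.
have P0 : P = 0 by apply/eqP; rewrite eq_le P_le0.
have := psd (- (Q + 1)) r; have := sqr_ge0 r; rewrite P0; nra.
Qed.

Lemma dot_le_norm2 (m : nat) (x y : 'cV[R]_m) : `|dot x y| <= norm2 x * norm2 y.
Proof.
rewrite -ler_sqr ?nnegrE ?mulr_ge0 ?norm2_ge0 //.
rewrite real_normK ?num_real // exprMn; apply: sqr_le_psd => al be.
by rewrite -norm2_sqr_comb sqr_ge0.
Qed.

Lemma norm2_triangle (m : nat) (x y : 'cV[R]_m) :
  norm2 (x + y) <= norm2 x + norm2 y.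
Proof.
rewrite -ler_sqr ?nnegrE ?addr_ge0 ?norm2_ge0 //.
have := norm2_sqr_comb x y 1 1; rewrite !scale1r => ->.
have := dot_le_norm2 x y; have := ler_norm (dot x y); nra.
Qed.

Lemma norm2N (m : nat) (x : 'cV[R]_m) : norm2 (- x) = norm2 x.
Proof. by congr Num.sqrt; apply: eq_bigr => i _; rewrite mxE sqrrN. Qed.

Lemma norm2_mulmx_bound (n p : nat) (M : 'M[R]_(n, p)) (x : 'cV[R]_p) :
  norm2 (M *m x) ^+ 2 <= (\sum_(i < n) \sum_(j < p) M i j ^+ 2) * norm2 x ^+ 2.
Proof.
rewrite sqr_norm2 mulr_suml; apply: ler_sum => i _; rewrite -expr2.
have -> : (M *m x) i 0 = dot (row i M)^T x.
  by rewrite mxE; apply: eq_bigr => j _; rewrite !mxE.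
have -> : \sum_(j < p) M i j ^+ 2 = norm2 (row i M)^T ^+ 2.
  by rewrite sqr_norm2; apply: eq_bigr => j _; rewrite !mxE expr2.
rewrite -exprMn -[leLHS]real_normK ?num_real //.
by rewrite ler_sqr ?nnegrE ?mulr_ge0 ?norm2_ge0 // dot_le_norm2.
Qed.

End Euclid.

(** * Largest entries of a finite family *)

Section LargestEntries.
Context {R : realType} {I : finType}.
Implicit Types (f : I -> R) (S T : {set I}).

Lemma exists_top_set_card f T (s : nat) : (s <= #|T|)%N ->
  exists S, [/\ S \subset T, #|S| = s &
    {in S & T :\: S, forall i j, f j <= f i}].
Proof.
elim: s => [_|s IHs s_lt].
  by exists set0; split; rewrite ?sub0set ?cards0 // => i j; rewrite inE.
have [S [ST cS topS]] := IHs (ltnW s_lt).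
have [k0 k0T] : exists k, k \in T :\: S.
  by apply/set0Pn; rewrite -card_gt0 cardsDS // cS subn_gt0.
have [k kT kmax] : exists2 k, k \in T :\: S & {in T :\: S, forall j, f j <= f k}.
  by case: (arg_maxP f k0T) => k kT kmax; exists k.
have [kS kTT] : k \notin S /\ k \in T by move: kT; rewrite inE => /andP[].
exists (k |: S); split.
- by rewrite subUset sub1set kTT.
- by rewrite cardsU1 kS cS.
- move=> i j; rewrite !inE negb_or => /orP[/eqP->|iS] /andP[/andP[_ jS] jT].
    by apply: kmax; rewrite inE jS.
  by apply: topS; rewrite ?inE ?jS.
Qed.

(** The [s] largest entries of [f] on [T] with a threshold [m] separating them from
    the rest.  The equation [#|S| * m = s * m] lets one treat a set [T] with fewer
    than [s] elements on the same footing: then [S = T] and [m = 0], as if [S] were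
    padded with zero entries. *)
Lemma exists_top_set f T (s : nat) : (0 < s)%N -> (forall i, 0 <= f i) ->
  exists S (m : R), [/\ S \subset T, (#|S| <= s)%N, 0 <= m,
     #|S|%:R * m = s%:R * m &
     [/\ {in S, forall i, m <= f i}, {in T :\: S, forall i, f i <= m} &
       S = set0 -> T = set0]].
Proof.
move=> s_gt0 f_ge0; have [s_le|s_gt] := leqP s #|T|; last first.
  exists T, 0; split; rewrite ?mulr0 //; first exact: ltnW.
  by split=> // i; rewrite ?setDv ?inE.
have [S [ST cS topS]] := exists_top_set_card f s_le.
have [i0 i0S] : exists i, i \in S by apply/set0Pn; rewrite -card_gt0 cS.
have [k kS kmin] : exists2 k, k \in S & {in S, forall j, f k <= f j}.
  by case: (arg_minP f i0S) => k kS kmin; exists k.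
exists S, (f k); split; rewrite ?cS //; split => // [i iT|S0].
  exact: topS.
by rewrite S0 inE in i0S.
Qed.

(** Only the excesses [f i - m] over the threshold matter, and they are nonnegative
    on [S0] and nonpositive off it. *)
Lemma sum_le_top_set f S0 S (s : nat) (m : R) : 0 <= m ->
  #|S0|%:R * m = s%:R * m -> (#|S| <= s)%N ->
  {in S0, forall i, m <= f i} -> {in ~: S0, forall i, f i <= m} ->
  \sum_(i in S) f i <= \sum_(i in S0) f i.
Proof.
move=> m_ge0 cS0 cS mS0 mS0c.
have excess (T : {set I}) : \sum_(i in T) f i = \sum_(i in T) (f i - m) + #|T|%:R * m.
  by rewrite sumrB sumr_const mulr_natl subrK.
rewrite !excess cS0; apply: lerD; last by rewrite ler_wpM2r // ler_nat.
rewrite [leLHS]big_mkcond [leRHS]big_mkcond; apply: ler_sum => i _ /=.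
have [iS0|iS0] := boolP (i \in S0).
  by case: ifP => // _; rewrite subr_ge0 mS0.
by case: ifP => // _; rewrite subr_le0 mS0c // inE.
Qed.

(** Square-root lifting inequality: since [(f i - m) * (mu - f i) >= 0], the sum of
    squares is at most [(m + mu) * A - s * m * mu], where [A] is the sum of the
    entries; completing the square in [A] bounds this by the square of the
    right-hand side. *)
Lemma sqrt_sum_sqr_le f S (s : nat) (m mu : R) : (0 < s)%N -> 0 <= m -> m <= mu ->
  #|S|%:R * m = s%:R * m -> {in S, forall i, m <= f i <= mu} ->
  Num.sqrt (\sum_(i in S) f i ^+ 2) <=
  (\sum_(i in S) f i) / Num.sqrt s%:R + Num.sqrt s%:R / 4 * (mu - m).
Proof.
move=> s_gt0 m_ge0 m_le cS fS.
set A := \sum_(i in S) f i; set q := Num.sqrt s%:R.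
have q_gt0 : 0 < q by rewrite sqrtr_gt0 ltr0n.
have qq : q ^+ 2 = s%:R by rewrite sqr_sqrtr // ler0n.
have A_ge0 : 0 <= A.
  by apply: sumr_ge0 => i /fS /andP[mf _]; exact: le_trans mf.
have sum_le : \sum_(i in S) f i ^+ 2 <= (m + mu) * A - q ^+ 2 * m * mu.
  have -> : (m + mu) * A - q ^+ 2 * m * mu = \sum_(i in S) ((m + mu) * f i - m * mu).
    by rewrite sumrB -mulr_sumr sumr_const qq -cS -mulrA mulr_natl.
  apply: ler_sum => i /fS /andP[m_le_f f_le_mu]; rewrite -subr_ge0.
  rewrite [leRHS](_ : _ = (f i - m) * (mu - f i)); last by ring.
  by rewrite mulr_ge0 ?subr_ge0.
have q_ge0 := ltW q_gt0.
have bound_ge0 : 0 <= A / q + q / 4 * (mu - m).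
  by apply: addr_ge0; [exact: divr_ge0|apply: mulr_ge0; [exact: divr_ge0|rewrite subr_ge0]].
rewrite -(ger0_norm bound_ge0).
rewrite -sqrtr_sqr ler_wsqrtr //; apply: le_trans sum_le _.
set B := A / q; have -> : A = B * q by rewrite divfK ?gt_eqF.
(* With [B = A / sqrt s] the gap is a square plus [s * m * (mu - m) / 2]. *)
rewrite -subr_ge0 [leRHS](_ : _ = (B - q * (mu + 3 * m) / 4) ^+ 2 +
    q ^+ 2 * (m * (mu - m)) / 2); last by field.
by rewrite addr_ge0 ?sqr_ge0 ?divr_ge0 ?mulr_ge0 ?sqr_ge0 ?subr_ge0.
Qed.

(** Peel off blocks of [s] largest entries.  The threshold of each block bounds all
    later entries, so the terms [sqrt s / 4 * (mu - m)] telescope to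
    [sqrt s / 4 * mu], whatever the number of blocks.  Stating this for an additive
    set function [G] allows an induction on [T] without naming the blocks. *)
Lemma additive_le_blocks f (s : nat) (G : {set I} -> R) (kappa : R) :
  (0 < s)%N -> (forall i, 0 <= f i) -> 0 <= kappa -> G set0 = 0 ->
  (forall S T, [disjoint S & T] -> G (S :|: T) = G S + G T) ->
  forall T (mu : R), 0 <= mu -> {in T, forall i, f i <= mu} ->
  (forall S, S \subset T -> (#|S| <= s)%N ->
     G S <= kappa * Num.sqrt (\sum_(i in S) f i ^+ 2)) ->
  G T <= kappa * ((\sum_(i in T) f i) / Num.sqrt s%:R + Num.sqrt s%:R / 4 * mu).
Proof.
move=> s_gt0 f_ge0 k_ge0 G0 GU T.
have [n] := ubnP #|T|; elim: n T => // n IHn T /ltnSE cT mu mu_ge0 fT GT.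
have q_ge0 : 0 <= Num.sqrt s%:R :> R by exact: sqrtr_ge0.
have [->|T_n0] := eqVneq T set0.
  by rewrite G0 big_set0 mul0r add0r !mulr_ge0 // invr_ge0.
have [S [m [ST cS m_ge0 cSm [mS mT S_n0]]]] := exists_top_set T s_gt0 f_ge0.
have {}S_n0 : S != set0 by apply: contraNneq T_n0 => /S_n0 ->.
have [i0 i0S] := set0Pn _ S_n0.
have subT i : i \in S -> i \in T by exact: (subsetP ST).
have m_le : m <= mu by exact: le_trans (mS _ i0S) (fT _ (subT _ i0S)).
have DT : T = S :|: (T :\: S) by rewrite -{1}(setID T S) (setIidPr ST).
have disj : [disjoint S & T :\: S] by rewrite -setI_eq0 setIDA setDIl setDv set0I.
rewrite {1}DT GU // (big_setID S) /= (setIidPr ST).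
have leS : G S <= kappa * ((\sum_(i in S) f i) / Num.sqrt s%:R + Num.sqrt s%:R / 4 * (mu - m)).
  apply: le_trans (GT _ ST cS) _; rewrite ler_wpM2l //.
  by apply: sqrt_sum_sqr_le => // i iS; rewrite mS //= fT // subT.
have leT : G (T :\: S) <=
    kappa * ((\sum_(i in T :\: S) f i) / Num.sqrt s%:R + Num.sqrt s%:R / 4 * m).
  apply: IHn => //.
    by rewrite cardsDS //; apply: leq_trans cT; rewrite ltn_subrL !card_gt0 S_n0 T_n0.
  move=> S' S'T; apply: GT; exact: subset_trans S'T (subsetDl _ _).
apply: le_trans (lerD leS leT) _; rewrite -mulrDr ler_wpM2l //.
by rewrite le_eqVlt; apply/orP; left; apply/eqP; ring.
Qed.

End LargestEntries.

(** * The robust null space property *)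

Section RestrictedIsometry.
Context {R : realType}.

Definition rip (n p s : nat) (M : 'M[R]_(n, p)) (a b : R) : Prop :=
  forall x, sparse s x ->
    a * norm2 x ^+ 2 <= norm2 (M *m x) ^+ 2 <= b * norm2 x ^+ 2.

(** The supremum over [q] in [[a, b]] of [sqrt ((b - q) * (q - a)) / q], attained at
    the harmonic mean of [a] and [b]. *)
Definition coherence (a b : R) : R := (b - a) / (2 * Num.sqrt (a * b)).

Definition nsp_slope (a b : R) : R := coherence a b / (1 - coherence a b / 4).

Definition nsp_noise (a b : R) : R := (Num.sqrt a * (1 - coherence a b / 4))^-1.

Definition restr (p : nat) (S : {set 'I_p}) (v : 'cV[R]_p) : 'cV[R]_p :=
  \col_i (if i \in S then v i 0 else 0).

Definition l1_on (p : nat) (S : {set 'I_p}) (v : 'cV[R]_p) : R :=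
  \sum_(i in S) `|v i 0|.

Lemma l1_on_ge0 p (S : {set 'I_p}) (v : 'cV[R]_p) : 0 <= l1_on S v.
Proof. by apply: sumr_ge0. Qed.

Lemma norm1_split p (S : {set 'I_p}) (v : 'cV[R]_p) :
  norm1 v = l1_on S v + l1_on (~: S) v.
Proof.
rewrite /norm1 (bigID (mem S)) /=; congr (_ + _).
by apply: eq_bigl => i; rewrite inE.
Qed.

Lemma restr_set0 p (v : 'cV[R]_p) : restr set0 v = 0.
Proof. by apply/colP => i; rewrite !mxE inE. Qed.

Lemma restr_setU p (S T : {set 'I_p}) (v : 'cV[R]_p) : [disjoint S & T] ->
  restr (S :|: T) v = restr S v + restr T v.
Proof.
move=> dST; apply/colP => i; rewrite !mxE inE.
have [iS|_] := boolP (i \in S); last by rewrite add0r.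
by rewrite (disjointFr dST iS) addr0.
Qed.

Lemma restr_split p (S : {set 'I_p}) (v : 'cV[R]_p) :
  v = restr S v + restr (~: S) v.
Proof.
rewrite -restr_setU -?setI_eq0 ?setICr // setUCr.
by apply/colP => i; rewrite !mxE inE.
Qed.

Lemma norm2_restr p (S : {set 'I_p}) (v : 'cV[R]_p) :
  norm2 (restr S v) = Num.sqrt (\sum_(i in S) `|v i 0| ^+ 2).
Proof.
congr Num.sqrt; rewrite [RHS]big_mkcond; apply: eq_bigr => i _; rewrite mxE.
by case: ifP => _; rewrite ?real_normK ?num_real // expr0n.
Qed.

Lemma dot_restr_disjoint p (S T : {set 'I_p}) (v w : 'cV[R]_p) :
  [disjoint S & T] -> dot (restr S v) (restr T w) = 0.
Proof.
move=> dST; rewrite /dot big1 // => i _; rewrite !mxE.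
have [iS|_] := boolP (i \in S); last by rewrite mul0r.
by rewrite (disjointFr dST iS) mulr0.
Qed.

Lemma sparse_comb_restr p (S T : {set 'I_p}) (s : nat) (v w : 'cV[R]_p) (al be : R) :
  (#|S| <= s)%N -> (#|T| <= s)%N ->
  sparse (2 * s) (al *: restr S v + be *: restr T w).
Proof.
move=> cS cT; rewrite /sparse /=.
apply: (@leq_trans #|S :|: T|).
  apply: subset_leq_card; apply/subsetP => i; rewrite !inE !mxE.
  by case: (i \in S) => //; case: (i \in T) => //; rewrite !mulr0 addr0 eqxx.
by rewrite mul2n -addnn (leq_trans (leq_card_setU S T)) // leq_add.
Qed.

Lemma coherence_ge0 (a b : R) : 0 < a -> a <= b -> 0 <= coherence a b.
Proof. by move=> a0 ab; rewrite divr_ge0 ?subr_ge0 // mulr_ge0 ?sqrtr_ge0. Qed.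

Lemma nsp_slope_ge0 (a b : R) :
  0 < a -> a <= b -> coherence a b < 4 -> 0 <= nsp_slope a b.
Proof.
move=> a0 ab k4; rewrite /nsp_slope; have := coherence_ge0 a0 ab.
by move: (coherence a b) k4 => k k4 k0; rewrite divr_ge0 //; lra.
Qed.

Lemma nsp_noise_gt0 (a b : R) : 0 < a -> coherence a b < 4 -> 0 < nsp_noise a b.
Proof.
move=> a0 k4; rewrite invr_gt0 mulr_gt0 ?sqrtr_gt0 //.
by move: (coherence a b) k4 => k k4; lra.
Qed.

Lemma sqr_coherence (a b : R) : 0 < a -> a <= b ->
  coherence a b ^+ 2 * (4 * a * b) = (b - a) ^+ 2.
Proof.
move=> a0 ab; have b0 : 0 < b by apply: lt_le_trans ab.
rewrite /coherence expr_div_n exprMn sqr_sqrtr; last by rewrite mulr_ge0 ?ltW.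
by field; rewrite !gt_eqF.
Qed.

(** Two discriminant inequalities, for [|M x|^2 - a |x|^2] and [b |x|^2 - |M x|^2] on
    the span of [u] and [w], are added with weights that eliminate [|M w|^2]. What
    remains, [<M u, M w>^2 |u|^2 <= (|M u|^2 - a |u|^2) (b |u|^2 - |M u|^2) |w|^2],
    is then maximized over the ratio of [|M u|^2] to [|u|^2]. *)
Lemma near_orthogonality n p (M : 'M[R]_(n, p)) (u w : 'cV[R]_p) (a b : R) :
  0 < a -> a <= b -> dot u w = 0 ->
  (forall al be, let x := al *: u + be *: w in
     a * norm2 x ^+ 2 <= norm2 (M *m x) ^+ 2 <= b * norm2 x ^+ 2) ->
  `|dot (M *m u) (M *m w)| * norm2 u <=
    coherence a b * norm2 (M *m u) ^+ 2 * norm2 w.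
Proof.
move=> a0 ab uw sandwich; have b0 : 0 < b by apply: lt_le_trans ab.
move: (coherence a b) (coherence_ge0 a0 ab) (sqr_coherence a0 ab) => k k_ge0 kE.
rewrite -ler_sqr ?nnegrE ?mulr_ge0 ?sqr_ge0 ?norm2_ge0 //.
rewrite !exprMn real_normK ?num_real //.
set r := dot _ _; set U := norm2 u ^+ 2; set W := norm2 w ^+ 2.
set Q := norm2 (M *m u) ^+ 2.
set Q' := norm2 (M *m w) ^+ 2.
have U_ge0 : 0 <= U by exact: sqr_ge0.
have W_ge0 : 0 <= W by exact: sqr_ge0.
have form al be : a * (al ^+ 2 * U + be ^+ 2 * W) <=
    al ^+ 2 * Q + 2 * al * be * r + be ^+ 2 * Q' <=
    b * (al ^+ 2 * U + be ^+ 2 * W).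
  have /= := sandwich al be; rewrite mulmxDr -!scalemxAr !norm2_sqr_comb uw.
  by rewrite mulr0 addr0.
have low : r ^+ 2 <= (Q - a * U) * (Q' - a * W).
  by apply: sqr_le_psd => al be; have /andP[] := form al be; lra.
have high : r ^+ 2 <= (b * U - Q) * (b * W - Q').
  rewrite -sqrrN; apply: sqr_le_psd => al be; have /andP[] := form al be; lra.
have aU : 0 <= Q - a * U by have /andP[] := form 1 0; lra.
have bU : 0 <= b * U - Q by have /andP[] := form 1 0; lra.
have : r ^+ 2 * U <= (Q - a * U) * (b * U - Q) * W.
  (* The weights below add up to [(b - a) * U], so equality is treated apart. *)
  have [ba|ab_eq] : a < b \/ a = b by case: ltgtP ab => //; [left|right].
    rewrite -(ler_pM2l (_ : 0 < b - a)) ?subr_gt0 //.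
    have := ler_wpM2l bU low; have := ler_wpM2l aU high.
    by move=> h1 h2; have := lerD h1 h2; lra.
  have QE : Q = a * U by move: bU; rewrite -ab_eq => bU; lra.
  have r0 : r ^+ 2 = 0.
    by apply/eqP; rewrite eq_le sqr_ge0 andbT; move: low; rewrite QE subrr mul0r.
  by rewrite r0 QE subrr !mul0r.
move=> rU; rewrite -(ler_pM2r (_ : 0 < 4 * a * b)) ?mulr_gt0 //.
have -> : k ^+ 2 * Q ^+ 2 * W * (4 * a * b) = (b - a) ^+ 2 * Q ^+ 2 * W.
  by rewrite -kE; ring.
have abr : 0 <= 4 * a * b by rewrite !mulr_ge0 ?ltW.
apply: le_trans (ler_wpM2r abr rU) _; rewrite -subr_ge0.
rewrite [leRHS](_ : _ = ((a + b) * Q - 2 * a * b * U) ^+ 2 * W); last by ring.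
by rewrite mulr_ge0 ?sqr_ge0.
Qed.

(** The expansion of [|M v_S|^2] described above, divided by [|M v_S|^2 / |v_S|].
    The factor [1/4] in [sqrt s / 4 * m <= |v_S| / 4] comes from the square-root
    lifting inequality; it moves to the left-hand side and turns [coherence] into
    [nsp_slope]. *)
Lemma robust_null_space n p (s : nat) (M : 'M[R]_(n, p)) (a b : R)
    (v : 'cV[R]_p) (S : {set 'I_p}) (m : R) :
  (0 < s)%N -> 0 < a -> a <= b -> coherence a b < 4 -> rip (2 * s) M a b ->
  (#|S| <= s)%N -> 0 <= m -> #|S|%:R * m = s%:R * m ->
  {in S, forall i, m <= `|v i 0|} -> {in ~: S, forall i, `|v i 0| <= m} ->
  norm2 (restr S v) <=
    nsp_slope a b / Num.sqrt s%:R * l1_on (~: S) v + nsp_noise a b * norm2 (M *m v).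
Proof.
move=> s_gt0 a0 ab k4 ripM cS m_ge0 cSm mS mSc.
have k_ge0 := coherence_ge0 a0 ab.
set u := restr S v; set N := norm2 u; set Q := norm2 (M *m u).
set k := coherence a b in k4 k_ge0 *; set q := Num.sqrt s%:R.
have q_gt0 : 0 < q by rewrite sqrtr_gt0 ltr0n.
have sa_gt0 : 0 < Num.sqrt a by rewrite sqrtr_gt0.
have k4' : 0 < 1 - k / 4 by lra.
have L_ge0 := l1_on_ge0 (~: S) v.
have N_ge0 : 0 <= N by exact: norm2_ge0.
have [N0|N_gt0] : N = 0 \/ 0 < N.
  by move: N_ge0; rewrite le_eqVlt => /orP[/eqP|]; [left|right].
  rewrite N0; apply: addr_ge0; apply: mulr_ge0 => //; last exact: norm2_ge0.
    by rewrite divr_ge0 ?nsp_slope_ge0 ?(ltW q_gt0).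
  exact: ltW (nsp_noise_gt0 _ _).
have QN : Num.sqrt a * N <= Q.
  rewrite -ler_sqr ?nnegrE ?mulr_ge0 ?norm2_ge0 ?sqrtr_ge0 // exprMn sqr_sqrtr ?(ltW a0) //.
  have := @ripM (1 *: u + 0 *: u) (sparse_comb_restr v v 1 0 cS cS).
  by rewrite scale1r scale0r addr0 => /andP[].
have Q_gt0 : 0 < Q by apply: lt_le_trans QN; rewrite mulr_gt0.
(* All [s] entries of [v] on [S] are at least [m] in modulus. *)
have qm_le : q * m <= N.
  rewrite -ler_sqr ?nnegrE ?mulr_ge0 ?(ltW q_gt0) // exprMn sqr_sqrtr ?ler0n //.
  rewrite /N norm2_restr sqr_sqrtr ?sumr_ge0 // => [|i _]; last exact: sqr_ge0.
  rewrite expr2 mulrA -cSm -mulrA -expr2 mulr_natl -sumr_const.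
  by apply: ler_sum => i iS; rewrite ler_sqr ?nnegrE // mS.
pose G T := - dot (M *m u) (M *m restr T v).
have G_le : G (~: S) <= k * Q ^+ 2 / N * (l1_on (~: S) v / q + q / 4 * m).
  apply: (additive_le_blocks (f := fun i => `|v i 0|) (G := G)) => //.
  - by apply: divr_ge0 => //; apply: mulr_ge0 => //; exact: sqr_ge0.
  - by rewrite /G restr_set0 mulmx0 dot0r oppr0.
  - by move=> T1 T2 d; rewrite /G restr_setU // mulmxDr dotDr opprD.
  - move=> T TS cT; rewrite -norm2_restr mulrAC ler_pdivlMr //.
    apply: le_trans (near_orthogonality a0 ab _ _); last first.
    + by move=> al be /=; apply: ripM; exact: sparse_comb_restr.
    + by apply: dot_restr_disjoint; rewrite disjoint_sym disjoints_subset.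
    + by rewrite ler_pM2r // -normrN ler_norm.
have main : Q ^+ 2 <= Q * norm2 (M *m v) + G (~: S).
  have -> : Q ^+ 2 = dot (M *m u) (M *m v) + G (~: S).
    by rewrite /G {1}(restr_split S v) mulmxDr dotDr addrK -sqr_norm2.
  by rewrite lerD2r; apply: le_trans (dot_le_norm2 _ _); exact: ler_norm.
have Qa : N / Q <= (Num.sqrt a)^-1 by rewrite ler_pdivrMr // ler_pdivlMl.
have step : N <= norm2 (M *m v) / Num.sqrt a + k * (l1_on (~: S) v / q + N / 4).
  have NE : N = Q ^+ 2 * (N / Q ^+ 2) by rewrite mulrC divfK // gt_eqF ?exprn_gt0.
  have NQ : 0 <= N / Q ^+ 2 by rewrite divr_ge0 ?sqr_ge0.
  rewrite [leLHS]NE; apply: le_trans (ler_wpM2r NQ (le_trans main (lerD (lexx _) G_le))) _.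
  rewrite [leLHS](_ : _ = norm2 (M *m v) * (N / Q) + k * (l1_on (~: S) v / q + q / 4 * m)); last first.
    by field; rewrite !gt_eqF.
  apply: lerD; first by rewrite ler_wpM2l ?norm2_ge0.
  by rewrite ler_wpM2l // lerD2l; lra.
rewrite [leRHS](_ : _ = (norm2 (M *m v) / Num.sqrt a + k * (l1_on (~: S) v / q)) / (1 - k / 4)); last first.
  by rewrite /nsp_slope /nsp_noise -/k; field; rewrite !gt_eqF //; lra.
rewrite ler_pdivlMr //; lra.
Qed.

End RestrictedIsometry.

(** * From the null space property to recovery *)

Section Recovery.
Context {R : realType}.

(** A competitor of smaller l1 norm pays for its mass off [S] by what it loses on [S],
    up to the part of [x0] that lies off [S]. *)
Lemma cone_inequality p (x0 xh : 'cV[R]_p) (S : {set 'I_p}) :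
  norm1 xh <= norm1 x0 ->
  l1_on (~: S) (x0 - xh) <= l1_on S (x0 - xh) + 2 * l1_on (~: S) x0.
Proof.
rewrite (norm1_split S xh) (norm1_split S x0) => xh_le.
have on_S : l1_on S x0 <= l1_on S (x0 - xh) + l1_on S xh.
  rewrite -big_split; apply: ler_sum => i _; rewrite !mxE.
  by apply: le_trans (ler_normD _ _); rewrite subrK.
have off_S : l1_on (~: S) (x0 - xh) <= l1_on (~: S) x0 + l1_on (~: S) xh.
  rewrite -big_split; apply: ler_sum => i _; rewrite !mxE.
  exact: ler_normB.
lra.
Qed.

Lemma l1_off_support_le p (x0 x : 'cV[R]_p) :
  l1_on (~: [set i | x i 0 != 0]) x0 <= norm1 (x0 - x).
Proof.
rewrite (norm1_split [set i | x i 0 != 0] (x0 - x)) -[leLHS]add0r.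
apply: lerD; first exact: l1_on_ge0.
apply: ler_sum => i; rewrite !inE negbK !mxE => /eqP ->.
by rewrite subr0.
Qed.

Lemma l1_le_norm2_restr p (s : nat) (S : {set 'I_p}) (v : 'cV[R]_p) :
  (#|S| <= s)%N -> l1_on S v <= Num.sqrt s%:R * norm2 (restr S v).
Proof.
move=> cS; rewrite norm2_restr -sqrtrM ?ler0n //.
rewrite -[leLHS]ger0_norm ?l1_on_ge0 // -sqrtr_sqr ler_wsqrtr //.
apply: le_trans (_ : _ <= #|S|%:R * \sum_(i in S) `|v i 0| ^+ 2) _; last first.
  by rewrite ler_wpM2r ?sumr_ge0 ?ler_nat // => i _; exact: sqr_ge0.
(* Cauchy-Schwarz against the constant family 1 on [S]. *)
apply: sqr_le_psd => al be.
rewrite [leRHS](_ : _ = \sum_(i in S) (al + be * `|v i 0|) ^+ 2).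
  by apply: sumr_ge0 => i _; exact: sqr_ge0.
rewrite -sumr_const !mulr_sumr -!big_split; apply: eq_bigr => i _ /=; ring.
Qed.

Definition rec_l1_slope (a b : R) : R :=
  2 * (1 + nsp_slope a b) / (1 - nsp_slope a b).

Definition rec_l1_noise (a b : R) : R := 4 * nsp_noise a b / (1 - nsp_slope a b).

(** The l2 constants dominate the l1 constants, so one pair serves both estimates. *)
Definition rec_slope (a b : R) : R := (1 + nsp_slope a b) * rec_l1_slope a b.

Definition rec_noise (a b : R) : R :=
  (1 + nsp_slope a b) * rec_l1_noise a b + 2 * nsp_noise a b.

Lemma nsp_slope_lt1 (a b : R) : coherence a b < 4 / 5 -> nsp_slope a b < 1.
Proof.
rewrite /nsp_slope; move: (coherence a b) => k k45.
by rewrite ltr_pdivrMr; lra.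
Qed.

(** Two index sets are involved: the cone inequality is used on the support [T] of
    the sparse competitor [x], the null space property on the set [S] of largest
    entries of [x0 - xh].  They are linked by comparing l1 norms, since [S] carries
    at least as much mass as [T]. For the l2 estimate, the entries off [S] are
    bounded by the mean modulus on [S] (Stechkin's inequality). *)
Lemma recovery_vs_sparse n p (s : nat) (M : 'M[R]_(n, p)) (a b eta : R)
    (x0 xh x : 'cV[R]_p) :
  (0 < s)%N -> 0 < a -> a <= b -> coherence a b < 4 / 5 -> rip (2 * s) M a b ->
  norm1 xh <= norm1 x0 -> norm2 (M *m (x0 - xh)) <= 2 * eta -> sparse s x ->
  norm1 (x0 - xh) <= rec_l1_slope a b * norm1 (x0 - x)
     + rec_l1_noise a b * Num.sqrt s%:R * eta /\
  norm2 (x0 - xh) <= rec_slope a b / Num.sqrt s%:R * norm1 (x0 - x)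
     + rec_noise a b * eta.
Proof.
move=> s_gt0 a0 ab k45 ripM xh_le noise x_sparse.
have k4 : coherence a b < 4 by lra.
set v := x0 - xh in noise *.
have f_ge0 (i : 'I_p) : 0 <= `|v i 0| by [].
have [S [m [_ cS m_ge0 cSm [mS mSc _]]]] := exists_top_set [set: 'I_p] s_gt0 f_ge0.
rewrite setTD in mSc.
have nsp := robust_null_space s_gt0 a0 ab k4 ripM cS m_ge0 cSm mS mSc.
have rho_ge0 := nsp_slope_ge0 a0 ab k4.
have rho_lt1 := nsp_slope_lt1 k45.
have tau_gt0 := nsp_noise_gt0 a0 k4.
rewrite /rec_slope /rec_noise /rec_l1_slope /rec_l1_noise.
move: (nsp_slope a b) (nsp_noise a b) nsp rho_ge0 rho_lt1 tau_gt0.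
move=> rho tau nsp rho_ge0 rho_lt1 tau_gt0.
set q := Num.sqrt s%:R in nsp *.
have q_gt0 : 0 < q by rewrite sqrtr_gt0 ltr0n.
set T := [set i | x i 0 != 0].
have cT : (#|T| <= s)%N by move: x_sparse; rewrite /sparse /= cardsE.
have T_le_S : l1_on T v <= l1_on S v by have := sum_le_top_set m_ge0 cSm cT mS mSc.
have vE := norm1_split S v; have vE' := norm1_split T v.
have S_ge0 := l1_on_ge0 S v; have Sc_ge0 := l1_on_ge0 (~: S) v.
have tnoise : tau * norm2 (M *m v) <= tau * (2 * eta) by rewrite ler_pM2l.
have nspS : l1_on S v <= rho * l1_on (~: S) v + 2 * tau * q * eta.
  apply: le_trans (l1_le_norm2_restr v cS) _.
  rewrite -/q mulrC -ler_pdivlMr //; apply: le_trans nsp _.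
  rewrite [leRHS](_ : _ = rho / q * l1_on (~: S) v + tau * (2 * eta)); last first.
    by field; rewrite gt_eqF.
  by rewrite lerD2l.
(* Both totals equal [norm1 v], so [S] carrying more mass than [T] also means that
   the complement of [S] carries less than that of [T]. *)
have nspT : l1_on T v <= rho * l1_on (~: T) v + 2 * tau * q * eta by nra.
have cone := cone_inequality T xh_le; rewrite -/v in cone.
have tail := l1_off_support_le x0 x; rewrite -/T in tail.
have l1 : norm1 v <= 2 * (1 + rho) / (1 - rho) * norm1 (x0 - x)
     + 4 * tau / (1 - rho) * q * eta.
  rewrite [leRHS](_ : _ = (2 * (1 + rho) * norm1 (x0 - x) + 4 * tau * q * eta) / (1 - rho)); last first.
    by field; rewrite gt_eqF // subr_gt0.
  rewrite ler_pdivlMr ?subr_gt0 // vE'; nra.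
split=> //.
have far : norm2 (restr (~: S) v) <= norm1 v / q.
  rewrite ler_pdivlMr // -ler_sqr ?nnegrE ?mulr_ge0 ?norm2_ge0 ?(ltW q_gt0) //;
    last by rewrite vE addr_ge0.
  rewrite exprMn norm2_restr !sqr_sqrtr ?ler0n ?sumr_ge0 // => [|i _];
    last exact: sqr_ge0.
  have far1 : \sum_(i in ~: S) `|v i 0| ^+ 2 <= m * l1_on (~: S) v.
    rewrite mulr_sumr; apply: ler_sum => i iS; rewrite expr2.
    by rewrite ler_wpM2r // mSc.
  have near1 : s%:R * m <= l1_on S v.
    rewrite -cSm mulr_natl -sumr_const; exact: ler_sum.
  have s_ge0 : 0 <= s%:R :> R by rewrite ler0n.
  have := ler_wpM2r s_ge0 far1; have := ler_wpM2r Sc_ge0 near1.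
  rewrite vE; nra.
have near : norm2 (restr S v) <= rho * (norm1 v / q) + tau * (2 * eta).
  apply: le_trans nsp _; apply: lerD => //.
  rewrite -mulrA ler_wpM2l // [leRHS]mulrC ler_wpM2l ?invr_ge0 ?(ltW q_gt0) //.
  by rewrite vE lerDr.
rewrite {1}(restr_split S v); apply: le_trans (norm2_triangle _ _) _.
have := ler_wpM2l (_ : 0 <= (1 + rho) / q) l1.
rewrite divr_ge0 ?(ltW q_gt0) ?addr_ge0 // => /(_ isT) l1q.
have [q0 r0] : q != 0 /\ 1 - rho != 0 by rewrite !gt_eqF // subr_gt0.
rewrite [leRHS](_ : _ = (1 + rho) / q * (2 * (1 + rho) / (1 - rho) * norm1 (x0 - x)
     + 4 * tau / (1 - rho) * q * eta) + tau * (2 * eta)); last by field; rewrite q0 r0.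
lra.
Qed.

Lemma le_affine_inf (A : set R) (c e y : R) : 0 < c -> (A !=set0)%classic ->
  (forall t, A t -> y <= c * t + e) -> y <= c * inf A + e.
Proof.
move=> c0 A0 yA; rewrite -lerBlDr mulrC -ler_pdivrMr //.
by apply: lb_le_inf => // t /yA; rewrite ler_pdivrMr // lerBlDr mulrC.
Qed.

Lemma SRSR_of_rip n p (s : nat) (M : 'M[R]_(n, p)) (a b : R) :
  (0 < s)%N -> 0 < a -> a <= b -> coherence a b < 4 / 5 -> rip (2 * s) M a b ->
  [/\ 0 < rec_slope a b, 0 < rec_noise a b & SRSR s M (rec_slope a b) (rec_noise a b)].
Proof.
move=> s_gt0 a0 ab k45 ripM; have k4 : coherence a b < 4 by lra.
have rho_ge0 := nsp_slope_ge0 a0 ab k4.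
have rho_lt1 := nsp_slope_lt1 k45.
have tau_gt0 := nsp_noise_gt0 a0 k4.
have rho1 : 0 < 1 + nsp_slope a b by lra.
have C1 : 0 < rec_l1_slope a b by rewrite divr_gt0 ?mulr_gt0 ?subr_gt0.
have D1 : 0 < rec_l1_noise a b by rewrite divr_gt0 ?mulr_gt0 ?subr_gt0.
have C0 : 0 < rec_slope a b by exact: mulr_gt0.
have D0 : 0 < rec_noise a b by rewrite addr_gt0 // mulr_gt0.
split=> // x0 eta e eta0 e_le xh [xh_feas xh_min].
have q_gt0 : 0 < Num.sqrt s%:R :> R by rewrite sqrtr_gt0 ltr0n.
have xh_le : norm1 xh <= norm1 x0.
  by apply: xh_min; rewrite /bpdn_feasible /= addrAC subrr add0r.
have noise : norm2 (M *m (x0 - xh)) <= 2 * eta.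
  have -> : M *m (x0 - xh) = (M *m x0 + e - M *m xh) + - e.
    by rewrite mulmxBr addrAC addrK.
  apply: le_trans (norm2_triangle _ _) _; rewrite norm2N.
  by move: xh_feas; rewrite /bpdn_feasible /=; lra.
have nonempty : ([set norm1 (x0 - x) | x in sparse s] !=set0)%classic.
  exists (norm1 (x0 - 0)), 0 => //; rewrite /sparse /= eq_card0 // => i.
  by rewrite !inE mxE eqxx.
have vs_sparse t : [set norm1 (x0 - x) | x in sparse s]%classic t ->
    norm1 (x0 - xh) <= rec_slope a b * t + rec_noise a b * Num.sqrt s%:R * eta /\
    norm2 (x0 - xh) <= rec_slope a b / Num.sqrt s%:R * t + rec_noise a b * eta.
  move=> [x x_sparse <-].
  have [l1 l2] := recovery_vs_sparse s_gt0 a0 ab k45 ripM xh_le noise x_sparse.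
  split=> //; apply: le_trans l1 _; apply: lerD.
    apply: ler_wpM2r; first exact: sumr_ge0.
    by rewrite /rec_slope; nra.
  apply: ler_wpM2r; first exact: ltW.
  apply: ler_wpM2r; first exact: ltW.
  by rewrite /rec_noise; nra.
split; apply: le_affine_inf => //; last 2 first.
- exact: divr_gt0.
- by move=> t /vs_sparse[].
- by move=> t /vs_sparse[].
Qed.

(** * Restricted isometry constants and the threshold on their ratio *)

(** Each inequality is closed in the constant, so it passes to the infimum; the
    admissible sets are nonempty because 1 is admissible for [cmin] and the squared
    Frobenius norm of [M] for [cmax]. *)
Lemma rip_cmin_cmax n p (s : nat) (M : 'M[R]_(n, p)) :
  [/\ 0 <= cmin s M <= 1, 0 <= cmax s M & rip s M (1 - cmin s M) (1 + cmax s M)].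
Proof.
pose Amin := [set c : R | 0 <= c /\
    forall x, sparse s x -> (1 - c) * norm2 x ^+ 2 <= norm2 (M *m x) ^+ 2]%classic.
pose Amax := [set c : R | 0 <= c /\
    forall x, sparse s x -> (1 + c) * norm2 x ^+ 2 >= norm2 (M *m x) ^+ 2]%classic.
have Amin1 : Amin 1 by split=> // x _; rewrite subrr mul0r sqr_ge0.
have Amin_lb : lbound Amin 0 by move=> c [].
have Amax_lb : lbound Amax 0 by move=> c [].
have Amax_n0 : (Amax !=set0)%classic.
  exists (\sum_(i < n) \sum_(j < p) M i j ^+ 2); split.
    by do 2!apply: sumr_ge0 => ? _; exact: sqr_ge0.
  move=> x _; apply: le_trans (norm2_mulmx_bound M x) _.
  by rewrite ler_wpM2r ?sqr_ge0 // lerDr.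
have Amin_n0 : (Amin !=set0)%classic by exists 1.
split.
- rewrite lb_le_inf //=; apply: ge_inf => //; by exists 0.
- exact: lb_le_inf.
move=> x xs; apply/andP; have := sqr_ge0 (norm2 x).
rewrite le_eqVlt => /orP[/eqP x0|x_gt0].
  have -> : x = 0.
    by apply: norm2_eq0; apply/eqP; rewrite -sqrf_eq0 -x0.
  by rewrite mulmx0 !sqr_norm2 !dot0r !mulr0.
split.
  rewrite -ler_pdivlMr // lerBlDr -lerBlDl.
  by apply: lb_le_inf => // c [_ /(_ _ xs)]; rewrite -ler_pdivlMr //; lra.
rewrite -ler_pdivrMr // -lerBlDl.
by apply: lb_le_inf => // c [_ /(_ _ xs)]; rewrite -ler_pdivrMr //; lra.
Qed.

(** [coherence a b < 4 / 5] means [25 (b - a)^2 < 64 a b], i.e. [b / a] lies strictly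
    between the roots [(57 - 8 sqrt 41) / 25] and [(57 + 8 sqrt 41) / 25]; the latter
    equals [(4 + sqrt 41)^2 / 25], and the former is less than 1. *)
Lemma coherence_lt (a b : R) : 0 < a -> a <= b ->
  b / a < (4 + Num.sqrt 41) ^+ 2 / 25 -> coherence a b < 4 / 5.
Proof.
move=> a0 ab; have b0 : 0 < b by apply: lt_le_trans ab.
have r41 : Num.sqrt 41 ^+ 2 = 41 :> R by rewrite sqr_sqrtr.
have r4 : 4 < Num.sqrt 41 :> R.
  by rewrite -ltr_sqr ?nnegrE ?sqrtr_ge0 // r41; lra.
rewrite ltr_pdivrMr //; move: (Num.sqrt 41) r41 r4 => r r41 r4 b_lt.
have {}b_lt : 0 < (57 + 8 * r) * a - 25 * b by nra.
have b_gt : 0 < 25 * b - (57 - 8 * r) * a by nra.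
have ab_lt : 25 * (b - a) ^+ 2 < 64 * (a * b).
  have := mulr_gt0 b_lt b_gt.
  have -> : ((57 + 8 * r) * a - 25 * b) * (25 * b - (57 - 8 * r) * a) =
      25 * (64 * (a * b) - 25 * (b - a) ^+ 2) + (64 * r ^+ 2 - 2624) * a ^+ 2 by ring.
  by rewrite r41; lra.
rewrite -ltr_sqr ?nnegrE ?coherence_ge0 //; last by rewrite divr_ge0.
rewrite -(ltr_pM2r (_ : 0 < 4 * a * b)) ?mulr_gt0 // sqr_coherence //; lra.
Qed.

End Recovery.

Theorem theorem1 (R : realType) :
  exists C D : R -> R -> R,
    forall (n p s : nat) (M : 'M[R]_(n, p)),
      (1 <= s)%N ->
      (ric_ratio (2 * s) M < ((4 + Num.sqrt 41) ^+ 2 / 25)%:E)%E ->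
      let cm := cmin (2 * s) M in
      let cM := cmax (2 * s) M in
      [/\ 0 < C cm cM, 0 < D cm cM & SRSR s M (C cm cM) (D cm cM)].
Proof.
exists (fun cm cM => rec_slope (1 - cm) (1 + cM)).
exists (fun cm cM => rec_noise (1 - cm) (1 + cM)).
move=> n p s M s_gt0; rewrite /ric_ratio.
have [/andP[cm0 cm1] cM0 ripM] := rip_cmin_cmax (2 * s) M.
case: eqP => [_|/eqP cm_neq1]; first by rewrite ltNge leey.
rewrite lte_fin => ratio /=.
have a_gt0 : 0 < 1 - cmin (2 * s) M by rewrite subr_gt0 lt_neqAle cm_neq1.
have ab : 1 - cmin (2 * s) M <= 1 + cmax (2 * s) M by lra.
by apply: SRSR_of_rip => //; exact: coherence_lt.
Qed.
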